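(* For every $n\ge1$, \[ \sum_{\pi\in S_n}\mathbf{x}_{\mathrm{RS}(\pi)}\,\mathbf{y}_{\mathrm{PKV}(\pi)}=\sum_{\pi\in S_n}\mathbf{x}_{\mathrm{RS}(\pi)}\,\mathbf{y}_{\mathrm{SPV}(\pi)} . \] In particular $\sum_{\pi\in S_n}\mathbf{y}_{\mathrm{PKV}(\pi)}=\sum_{\pi\in S_n}\mathbf{y}_{\mathrm{SPV}(\pi)}$.
   Context: For a finite set $T=\{t_1,\dots,t_m\}$ of positive integers, $\mathbf{x}_T=x_{t_1}\dotsm x_{t_m}$ and $\mathbf{y}_T=y_{t_1}\dotsm y_{t_m}$ (commuting variables). For $\pi\in S_n$ in one-line notation, the runs of $\pi$ are its maximal increasing contiguous subwords; $\mathrm{RS}(\pi)$ is the set of values that are the first entry of some run of $\pi$. $\mathrm{runsort}(\pi)$ is obtained by rearranging the runs of $\pi$ in lexicographic order (increasing first entries). An index $1<i<n$ is a peak if $\pi(i-1)<\pi(i)>\pi(i+1)$, with peak-value $\pi(i)$; $\mathrm{PKV}(\pi)$ is the set of peak-values and $\mathrm{SPV}(\pi)=\mathrm{PKV}(\mathrm{runsort}(\pi))$. *)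

(* Defs.v *)
From HB Require Import structures.
From mathcomp Require Import all_boot all_order all_fingroup all_algebra.
From mathcomp Require Import mpoly.

Set Implicit Arguments.
Unset Strict Implicit.
Unset Printing Implicit Defensive.

(* The values 1, ..., n are represented by the elements 0, ..., n - 1 of 'I_n,
   and positions in a word are also numbered from 0. *)

Section Words.

Variable n : nat.

Definition one_line (p : 'S_n) : seq 'I_n := [seq p i | i <- enum 'I_n].

Fixpoint runs (w : seq 'I_n) : seq (seq 'I_n) :=
  if w is x :: w' then
    if runs w' is (y :: r) :: rs then
      if x < y then (x :: y :: r) :: rs else [:: x] :: (y :: r) :: rs
    else [:: [:: x]]
  else [::].

Definition run_starts (w : seq 'I_n) : {set 'I_n} :=
  [set v in pmap ohead (runs w)].

(* seqlexi is the alias of seq ordered lexicographically. *)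
Definition runsort (w : seq 'I_n) : seq 'I_n :=
  flatten (sort (fun r s : seqlexi 'I_n => (r <= s)%O)
                (runs w)).

(* The default value v of nth is never used, since i < size w. *)
Definition peak_values (w : seq 'I_n) : {set 'I_n} :=
  [set v | [exists i : 'I_(size w),
     [&& 0 < i, i.+1 < size w, nth v w i == v,
         nth v w i.-1 < nth v w i & nth v w i.+1 < nth v w i]]].

Definition RS (p : 'S_n) : {set 'I_n} := run_starts (one_line p).

Definition PKV (p : 'S_n) : {set 'I_n} := peak_values (one_line p).

Definition SPV (p : 'S_n) : {set 'I_n} := peak_values (runsort (one_line p)).

(* In {mpoly int[n + n]} the first n variables are the x's and the last n
   are the y's: v : 'I_n stands for the value v + 1, so x_(v+1) is
   'X_(lshift n v) and y_(v+1) is 'X_(rshift n v). *)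
Definition xmon (T : {set 'I_n}) : {mpoly int[n + n]} :=
  (\prod_(v in T) 'X_(lshift n v))%R.

Definition ymon (T : {set 'I_n}) : {mpoly int[n + n]} :=
  (\prod_(v in T) 'X_(rshift n v))%R.

(* The four lemmas below say that runs w cuts w into its maximal increasing
   contiguous subwords, without empty pieces. *)

Lemma runs_nonnil w : [::] \notin runs w.
Proof.
elim: w => //= x w; case: (runs w) => [|[|y r] rs] //=.
by case: ifP => _; rewrite !inE.
Qed.

Lemma flatten_runs w : flatten (runs w) = w.
Proof.
elim: w => //= x w IHw; have := runs_nonnil w.
case: (runs w) IHw => [|[|y r] rs] //=; first by move=> <-.
by move=> IHw _; case: ifP; rewrite -IHw.
Qed.

Lemma runs_increasing w :
  all (sorted (fun x y : 'I_n => x < y)) (runs w).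
Proof.
elim: w => //= x w; case: (runs w) => [|[|y r] rs] //= /andP [Hr Hrs].
by case: ifP => Hxy /=; rewrite ?Hxy Hr Hrs.
Qed.

Lemma runs_maximal w (v : 'I_n) :
  sorted (fun r s => head v s <= last v r) (runs w).
Proof.
elim: w => //= x w; case: (runs w) => [|[|y r] rs] //=.
case: ltnP => Hxy //= Hp; first by case: rs Hp.
by rewrite Hxy.
Qed.

Lemma perm_runsort w : perm_eq (runsort w) w.
Proof.
rewrite -[X in perm_eq _ X]flatten_runs /runsort.
by apply/perm_flatten; rewrite perm_sort.
Qed.

End Words.

(* Main.v *)
(* Both sums are encoded by the same n! code words.  Read the values in
   increasing order, and let the state be a number J.  Each value is either a
   run start, in J + 1 ways with J -> J + 1 or in J ways with J unchanged; or a
   peak, in J - 1 ways with J -> J - 1; or neither, in J ways with J unchanged.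
   For PKV, J counts the maximal factors of letters already read: the next
   letter is a new factor, is prepended or appended to a factor, or joins two
   adjacent ones.  For SPV, J counts the runs that are still growing, together
   with the run started last, whether it grows or not.  A value that starts no
   run is appended to one of these J runs, and is a peak of the sorted word
   exactly if it closes a run other than the one started last.  A new run can
   stand only in front of the word or just after a run that is still growing, as
   the last letter of the run before it has to exceed its first letter; so the J
   or J + 1 places tell whether the run started last has stopped growing or not.
   The code determines the permutation, and there are exactly n! codes, so each
   encoding is a bijection. *)

Require Import Defs.
From mathcomp Require Import all_boot all_order all_fingroup all_algebra.
From mathcomp Require Import mpoly.
From mathcomp Require Import zify.

Set Implicit Arguments.
Unset Strict Implicit.
Unset Printing Implicit Defensive.

(* (a, b): the value starts a run iff a holds; if a holds, b says whether the
   state increases, and otherwise whether the value is a peak. *)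
Definition step := (bool * bool)%type.

(** * Code words and their number *)

Definition weight (t : step) (J : nat) : nat :=
  match t with
  | (true, true) => J.+1
  | (false, true) => J.-1
  | _ => J
  end.

Definition target (t : step) (J : nat) : nat :=
  match t with
  | (true, true) => J.+1
  | (false, true) => J.-1
  | _ => J
  end.

(** A code ends in state [1], or in state [0] if it starts there and is empty: [(false, true)] has
    weight [0] in states [0] and [1], so no code comes back to [0]. *)
Fixpoint codes (m J : nat) : seq (seq (step * nat)) :=
  if m is m'.+1 then
    flatten [seq [seq (t, i) :: c | i <- iota 0 (weight t J),
                                    c <- codes m' (target t J)]
            | t <- [:: (true, true); (true, false);
                       (false, false); (false, true)]]
  else if J <= 1 then [:: [::]] else [::].

(** Splitting off the first letter gives [N(m + 1, J) = (J + 1) N(m, J + 1) + 2 J N(m, J) + (J - 1)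
    N(m, J - 1)], which the closed form satisfies. At [J = 0] it gives [m!]; the induction passes
    through the other states. *)
Lemma size_codes m J : size (codes m J) = m`! * 'C(m.+1, J).
Proof.
elim: m J => [|m IHm] J.
  by case: J => [|[|J]] //=; rewrite fact0 mul1n bin_small.
rewrite /= !size_cat !size_allpairs !size_iota !IHm /= addn0 factS.
case: J => [|J] /=; rewrite size_map IHm; first by rewrite bin1 !bin0; lia.
have E1 := mul_bin_left m.+1 J.+1.
have E2 := mul_bin_left m.+1 J.
rewrite [in RHS]binS.
have [le_Jm|lt_mJ] := leqP J.+1 m.+1; last first.
  rewrite (@bin_small m.+1 J.+2) 1?(@bin_small m.+1 J.+1) //; try lia.
  rewrite (_ : 'C(m.+1, J) = (J == m.+1)).
    by case: eqP => [->|_] /=; lia.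
  case: eqP => [->|]; [exact: binn | by move=> ?; rewrite bin_small //; lia].
set a := 'C(m.+1, J.+2) in E1 *; set b := 'C(m.+1, J.+1) in E1 E2 *.
set c := 'C(m.+1, J) in E2 *; set f := m`!.
(* Up to the common factor [m!], the sum of [E1'] and [E2'] is the recurrence. *)
have E1' : J.+2 * a + J.+1 * b = m.+1 * b by rewrite E1 -mulnDl subnK.
have E2' : J.+1 * b + J * c = m.+1 * c.
  by rewrite E2 -mulnDl subnK // ltnW.
by nia.
Qed.

(** * From an injective encoding to the distribution of step sequences *)

Section Encoding.

Variables (P : finType) (obj : eqType) (rank : obj -> nat) (n : nat).
Variables (family : nat -> step -> obj -> seq obj).
Variables (node : nat -> P -> obj) (typ : nat -> P -> step) (o : obj).

Hypothesis node0 : forall p, node 0 p = o.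
Hypothesis rank0 : rank o = 0.
Hypothesis node_step : forall k p, k < n ->
  [/\ node k.+1 p \in family k (typ k p) (node k p),
      size (family k (typ k p) (node k p))
        <= weight (typ k p) (rank (node k p))
    & rank (node k.+1 p) = target (typ k p) (rank (node k p))].
Hypothesis rank_end : forall p, rank (node n p) <= 1.
Hypothesis node_inj : injective (node n).
Hypothesis cardP : #|P| = n`!.

Let letter p k :=
  (typ k p, index (node k.+1 p) (family k (typ k p) (node k p))).

Let code_in m k p : k + m = n ->
  [seq letter p i | i <- iota k m] \in codes m (rank (node k p)).
Proof.
elim: m k => [|m IHm] k; first by rewrite addn0 => -> /=; rewrite rank_end inE.
rewrite addnS => Ek; have lt_kn : k < n by lia.
have [Hin Hsz Hr] := node_step p lt_kn.
apply/flatten_mapP; exists (typ k p).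
  by case: (typ k p) => [[] []].
apply/allpairsP; exists ((letter p k).2, [seq letter p i | i <- iota k.+1 m]).
split => //=; last by rewrite -Hr; apply: IHm; lia.
by rewrite mem_iota /= add0n (leq_trans _ Hsz) // index_mem.
Qed.

(** The nodes are recovered one after the other: a node and a step fix the list of candidates, and
    the letter gives the position of the next node in it. *)
Let code_inj : injective (fun p => [seq letter p i | i <- iota 0 n]).
Proof.
move=> p q Epq; apply: node_inj.
suff H k : k <= n -> node k p = node k q by exact: H.
elim: k => [|k IHk] lt_kn; first by rewrite !node0.
have /eqP := congr1 (nth (letter p k) ^~ k) Epq.
rewrite !(nth_map 0) ?size_iota // !nth_iota // add0n => /eqP [Et Ei].
have [Hp _ _] := node_step p lt_kn; have [Hq _ _] := node_step q lt_kn.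
rewrite -(nth_index o Hp) -(nth_index o Hq) Ei.
by rewrite Et IHk // ltnW.
Qed.

(** The encoding is an injection into a list of length [n!], hence onto it. So upper bounds on the
    sizes of the families suffice; dropping the positions leaves the steps. *)
Lemma perm_steps :
  perm_eq [seq [seq typ k p | k <- iota 0 n] | p <- enum P]
          [seq [seq x.1 | x <- c] | c <- codes n 0].
Proof.
pose code p := [seq letter p i | i <- iota 0 n].
have Ucode : uniq (map code (enum P)).
  by rewrite map_inj_uniq ?enum_uniq //; exact: code_inj.
have sub : {subset map code (enum P) <= codes n 0}.
  move=> _ /mapP [p _ ->]; have := @code_in n 0 p (add0n n).
  by rewrite node0 rank0.
have Esz : size (codes n 0) <= size (map code (enum P)).
  by rewrite size_codes bin0 muln1 size_map -cardE cardP.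
have [_ Emem] := uniq_min_size Ucode sub Esz.
have Ucodes := leq_size_uniq Ucode sub Esz.
have := perm_map (map fst) (uniq_perm Ucode Ucodes Emem).
rewrite -map_comp.
by under eq_map => p do rewrite /= -map_comp.
Qed.

End Encoding.

(** * Maximal factors of small letters: the encoding for peaks of the word itself *)

Section Factors.

Implicit Types (k : nat) (w : seq nat).

(* The letters >= k are separators, so that pieces may be empty. *)
Fixpoint pieces k w : seq (seq nat) :=
  if w is x :: w' then
    if x < k then (x :: head [::] (pieces k w')) :: behead (pieces k w')
    else [::] :: pieces k w'
  else [:: [::]].

Lemma pieces_consE k w :
  pieces k w = head [::] (pieces k w) :: behead (pieces k w).
Proof. by case: w => [|x w] //=; case: ifP. Qed.

Lemma pieces_rconsE k w :
  pieces k w = rcons (belast (head [::] (pieces k w)) (behead (pieces k w)))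
                     (last [::] (pieces k w)).
Proof. by rewrite [pieces k w]pieces_consE /= lastI. Qed.

Lemma pieces_cut k w1 x w2 : k <= x ->
  pieces k (w1 ++ x :: w2) = pieces k w1 ++ pieces k w2.
Proof.
move=> le_kx; elim: w1 => [|y w1 IHw] /=; first by rewrite ltnNge le_kx.
rewrite IHw; case: ifP => // _.
by rewrite [pieces k w1]pieces_consE.
Qed.

Lemma pieces_join k w1 x w2 P u v Q : x < k ->
  pieces k w1 = rcons P u -> pieces k w2 = v :: Q ->
  pieces k (w1 ++ x :: w2) = P ++ (u ++ x :: v) :: Q.
Proof.
move=> lt_xk + E2; elim: w1 P u => [|y w1 IHw] P u /=.
  by case: P => [|? [|? ?]] //= [<-]; rewrite lt_xk E2.
case: ifP => _; last first.
  case: P => [|c P] /= [<-]; last by move=> /IHw ->.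
  by rewrite pieces_consE.
rewrite [pieces k w1]pieces_consE.
case: P => [|c P] /= [<-] Et.
  by rewrite (IHw [::] (head [::] (pieces k w1))) //= -Et -pieces_consE.
by rewrite (IHw (head [::] (pieces k w1) :: P) u) //= -Et -pieces_consE.
Qed.

Lemma pieces_succ k w : k \notin w -> pieces k.+1 w = pieces k w.
Proof.
elim: w => //= x w IHw; rewrite inE negb_or => /andP [/negPf ne_kx /IHw ->].
by rewrite ltnS leq_eqVlt eq_sym ne_kx.
Qed.

(** The default [k] of [head] lets the empty word count as one that begins with a separator: its
    only piece is empty. *)
Lemma head_pieces k w : (head [::] (pieces k w) == [::]) = (k <= head k w).
Proof. by case: w => [|x w] /=; rewrite ?leqnn // ltnNge; case: leqP. Qed.

Lemma last_pieces k w : (last [::] (pieces k w) == [::]) = (k <= last k w).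
Proof.
case/lastP: w => [|w x]; first by rewrite /= leqnn.
rewrite last_rcons -cats1; case: leqP => [le_kx|lt_xk].
  by rewrite pieces_cut //= last_cat.
rewrite (pieces_join lt_xk (pieces_rconsE k w) (erefl : pieces k [::] = _)).
by rewrite last_cat /=; case: (last _ _).
Qed.

Lemma pieces_all k w : all (ltn^~ k) w -> pieces k w = [:: w].
Proof. by elim: w => //= x w IHw /andP [-> /IHw ->]. Qed.

Definition factors k w := [seq c <- pieces k w | c != [::]].

Lemma factors0 w : factors 0 w = [::].
Proof. by rewrite /factors; elim: w. Qed.

Definition factor_family k (t : step) (s : seq (seq nat)) :=
  match t with
  | (true, true) =>
    [seq take i s ++ [:: k] :: drop i s | i <- iota 0 (size s).+1]
  | (true, false) =>
    [seq take i s ++ (k :: nth [::] s i) :: drop i.+1 s | i <- iota 0 (size s)]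
  | (false, false) =>
    [seq take i s ++ rcons (nth [::] s i) k :: drop i.+1 s
    | i <- iota 0 (size s)]
  | (false, true) =>
    [seq take i s ++ (nth [::] s i ++ k :: nth [::] s i.+1) :: drop i.+2 s
    | i <- iota 0 (size s).-1]
  end.

(** The defaults [k] make a missing neighbour count as a large one. Equality of the two tests has
    both meanings required of the flag: at a run start it says that no neighbour is small, so that a
    factor is created, and elsewhere that both are small, so that [k] is a peak. *)
Definition factor_type k w : step :=
  let w1 := take (index k w) w in let w2 := drop (index k w).+1 w in
  (k <= last k w1, (k <= last k w1) == (k <= head k w2)).

Lemma factor_typeE k w1 w2 : k \notin w1 ->
  factor_type k (w1 ++ k :: w2) =
    (k <= last k w1, (k <= last k w1) == (k <= head k w2)).
Proof.
move=> k_w1; rewrite /factor_type index_cat (negPf k_w1) /= eqxx addn0.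
by rewrite take_size_cat // -cat_rcons drop_size_cat // size_rcons.
Qed.

Lemma size_factor_family k t s :
  size (factor_family k t s) = weight t (size s).
Proof. by case: t => [[] []]; rewrite size_map size_iota. Qed.

(** Only the pieces [u] and [v] on the two sides of [k] change, and which of them are empty decides
    among the four types. The position in the family is the number of nonempty pieces before [u]. *)
Lemma factors_step k w : uniq w -> k \in w ->
  factors k.+1 w \in factor_family k (factor_type k w) (factors k w) /\
  size (factors k.+1 w) = target (factor_type k w) (size (factors k w)).
Proof.
move=> Uw k_w; case/splitPr: k_w Uw => w1 w2.
rewrite cat_uniq => /and3P [_ /norP [k_w1 _] /andP [k_w2 _]].
rewrite factor_typeE // -last_pieces -head_pieces /factors (@pieces_cut k) //.
rewrite -(pieces_succ k_w1) -(pieces_succ k_w2).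
move: (pieces_rconsE k.+1 w1) (pieces_consE k.+1 w2).
move: (last [::] (pieces k.+1 w1)) (head [::] (pieces k.+1 w2)).
move: (belast _ _) (behead (pieces _ w2)).
move=> P Q u v E1 E2. rewrite (pieces_join (ltnSn k) E1 E2) E1 E2.
rewrite !filter_cat filter_rcons /=.
have -> : (u ++ k :: v != [::]) by case: (u).
set p := filter _ P; set q := filter _ Q.
have nth_p d s : nth [::] (p ++ s) (size p + d) = nth [::] s d.
  by rewrite nth_cat -[X in _ < X]addn0 ltn_add2l ltn0 addKn.
have drop_p d (s : seq (seq nat)) : drop (size p + d) (p ++ s) = drop d s.
  by rewrite addnC -drop_drop drop_size_cat.
case: (altP (u =P [::])) => [->|u0]; case: (altP (v =P [::])) => [->|v0] /=;
  rewrite ?cat_rcons; (split; last by rewrite !size_cat /= ?addnS).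
- rewrite -{1}(take_size_cat q (erefl (size p))).
  rewrite -{2}(drop_size_cat q (erefl (size p))).
  apply: (@map_f _ _ (fun i => take i (p ++ q) ++ [:: k] :: drop i (p ++ q))
                 (iota 0 (size (p ++ q)).+1) (size p)).
  by rewrite mem_iota size_cat; lia.
- apply/mapP; exists (size p); rewrite ?mem_iota ?size_cat /=; first by lia.
  by rewrite take_size_cat // -addn1 drop_p -{1}[size p]addn0 nth_p /= drop0.
- apply/mapP; exists (size p); rewrite ?mem_iota ?size_cat /=; first by lia.
  rewrite take_size_cat // -addn1 drop_p -{1}[size p]addn0 nth_p /= drop0.
  by rewrite cats1.
- apply/mapP; exists (size p); rewrite ?mem_iota ?size_cat /=; first by lia.
  rewrite take_size_cat // -addn2 -addn1 drop_p -{1}[size p]addn0 !nth_p /=.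
  by rewrite drop0.
Qed.

End Factors.

(** * Run starts and peaks as conditions on neighbouring letters *)

Section Statistics.

Variable n : nat.
Implicit Types (v x : 'I_n) (w : seq 'I_n).

Fixpoint descent_bottoms x w : seq 'I_n :=
  if w is y :: w' then
    if x < y then descent_bottoms y w' else y :: descent_bottoms y w'
  else [::].

Lemma run_heads x w :
  pmap ohead (runs (x :: w)) = x :: descent_bottoms x w.
Proof.
elim: w x => //= y w IHw x; have := IHw y.
rewrite /=; case: (runs w) => [|[|z r] rs] //=.
- by case=> <-; case: ifP.
- by case=> <-; case: ifP.
- by case: (y < z) => /= [[<-]|[<-]]; case: ifP.
Qed.

Lemma descent_bottoms_sub x w : {subset descent_bottoms x w <= w}.
Proof.
elim: w x => //= y w IHw x v; rewrite [v \in y :: w]inE.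
case: ifP => _; last rewrite inE.
  by move/IHw=> ->; rewrite orbT.
by case/orP => [->|/IHw ->]; rewrite ?orbT.
Qed.

Lemma mem_descent_bottoms x w1 v w2 : uniq (x :: w1 ++ v :: w2) ->
  (v \in descent_bottoms x (w1 ++ v :: w2)) = (v < last x w1).
Proof.
elim: w1 x => [|y w1 IHw] x /=.
  rewrite inE negb_or -andbA eq_sym => /and4P [neq_xv _ v_w2 _].
  case: ltnP => [lt_xv|le_vx].
    by rewrite (negPf (contra (@descent_bottoms_sub v w2 v) v_w2)) ltnNge ltnW.
  by rewrite inE eqxx ltn_neqAle le_vx neq_xv.
move=> /andP [_ Uw]; have /= E := IHw y Uw.
case: ifP => // _; rewrite inE E; case: eqP => // Evy.
by move: Uw => /=; rewrite -Evy mem_cat inE eqxx orbT.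
Qed.

(** A letter starts a run iff it is first or follows a larger letter; the default [v] in a weak
    inequality covers the first case. *)
Lemma mem_run_starts w1 v w2 : uniq (w1 ++ v :: w2) ->
  (v \in run_starts (w1 ++ v :: w2)) = (v <= last v w1).
Proof.
rewrite inE; case: w1 => [|x w1] Uw; first by rewrite run_heads inE eqxx leqnn.
rewrite cat_cons run_heads inE mem_descent_bottoms //=.
move: Uw; rewrite cat_uniq => /and3P [_ /norP [v_w1 _] _].
have := memPn v_w1 _ (mem_last x w1); move: v_w1; rewrite inE => /norP [].
move=> /negPf -> _ neq_l.
by rewrite [RHS]leq_eqVlt eq_sym val_eqE (negPf neq_l).
Qed.

(** Here the inequalities are strict, so the same default excludes both ends of the word. *)
Lemma mem_peak_values w1 v w2 : uniq (w1 ++ v :: w2) ->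
  (v \in peak_values (w1 ++ v :: w2)) = (last v w1 < v) && (head v w2 < v).
Proof.
move=> Uw; rewrite inE; set w := w1 ++ _.
have nth_v : nth v w (size w1) = v by rewrite nth_cat ltnn subnn.
have Esz : size w = (size w1 + size w2).+1 by rewrite size_cat addnS.
have nth_pred : 0 < size w1 -> nth v w (size w1).-1 = last v w1.
  by move=> w1_gt0; rewrite nth_cat prednK // leqnn nth_last.
have nth_succ : nth v w (size w1).+1 = head v w2.
  by rewrite nth_cat ltnNge leqnSn /= subSnn /= nth0.
apply/existsP/andP => [[i /and5P [i_gt0 lt_i /eqP Ei]]|[lt_l lt_h]].
  have Ei' : nat_of_ord i = size w1.
    apply/eqP; rewrite -(nth_uniq v _ _ Uw) ?Ei ?nth_v //.
    by rewrite -/w Esz ltnS leq_addr.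
  by rewrite Ei' in i_gt0 *; rewrite nth_v nth_succ nth_pred.
have w1_gt0 : 0 < size w1 by case: (w1) lt_l; rewrite //= ltnn.
have w2_gt0 : 0 < size w2 by case: (w2) lt_h; rewrite //= ltnn.
have lt_i : size w1 < size w by rewrite Esz ltnS leq_addr.
exists (Ordinal lt_i); rewrite /= w1_gt0 nth_v eqxx nth_pred // nth_succ.
by rewrite lt_l lt_h Esz !andbT /= ltnS -{1}[size w1]addn0 ltn_add2l.
Qed.

End Statistics.

(** * Lists obtained by rewriting one eligible entry *)

Section ReplaceOne.

Variables (T : eqType) (P : pred T) (f : T -> seq T).

Fixpoint replace_one (s : seq T) : seq (seq T) :=
  if s is x :: s' then
    (if P x then [:: f x ++ s'] else [::]) ++ [seq x :: t | t <- replace_one s']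
  else [::].

Lemma size_replace_one s : size (replace_one s) = count P s.
Proof. by elim: s => //= x s IHs; rewrite size_cat size_map IHs; case: ifP. Qed.

Lemma mem_replace_one s1 x s2 : P x ->
  s1 ++ f x ++ s2 \in replace_one (s1 ++ x :: s2).
Proof.
move=> Px; elim: s1 => [|y s1 IHs] /=; first by rewrite Px mem_head.
by rewrite mem_cat map_f ?orbT.
Qed.

End ReplaceOne.

Lemma uniq_flatten_mem (T : eqType) (S : seq (seq T)) x X Y :
  uniq (flatten S) -> X \in S -> Y \in S -> x \in X -> x \in Y -> X = Y.
Proof.
elim: S => // Z S IHS /=; rewrite cat_uniq => /and3P [_ /hasPn dis US].
have no Z' : Z' \in S -> x \in Z' -> x \in Z -> False.
  by move=> Z'S xZ'; apply/negP; apply: dis; apply/flattenP; exists Z'.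
rewrite !inE => /orP [/eqP ->|XS] /orP [/eqP ->|YS] // xX xY.
- by case: (no _ YS xY xX).
- by case: (no _ XS xX xY).
- exact: IHS.
Qed.

(** * Growth of the runs, value by value: the encoding for peaks of the sorted word *)

Section RunBlocks.

(* A block is a run cut down to the values already read, with 2 if it is the
   run started last, 1 if it is another run that is still growing, and 0 if it
   is complete. *)
Definition block := (seq nat * nat)%type.

Definition active (b : block) := 0 < b.2.

(** Applied when a new run starts: the run started last until then gives up its mark, and [e] tells
    whether it is still growing. *)
Definition demote (e : bool) (b : block) : block :=
  if b.2 == 2 then (b.1, nat_of_bool e) else b.

(** Blocks stand in the order of the word. In the case [(false, false)] the run started last keeps
    its mark [2] even if it ends with [k]; a peak has to close a block marked [1]. *)
Definition block_family k (t : step) (s : seq block) : seq (seq block) :=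
  match t with
  | (true, e) =>
    let s' := map (demote e) s in
    (([:: k], 2) :: s') :: replace_one active (fun b => [:: b; ([:: k], 2)]) s'
  | (false, false) => replace_one active (fun b => [:: (rcons b.1 k, b.2)]) s
  | (false, true) =>
    replace_one (fun b => b.2 == 1) (fun b => [:: (rcons b.1 k, 0)]) s
  end.

Definition count_latest (s : seq block) := count (fun b => b.2 == 2) s.

(** With a single block marked [2], this leaves [J] active blocks if [e] holds and [J - 1]
    otherwise; together with the front of the word these are the [J + 1] or [J] places for a new
    run. *)
Lemma count_demote e s :
  count active (map (demote e) s) + ~~ e * count_latest s = count active s.
Proof.
rewrite /count_latest /active /demote; case: e; elim: s => //= b s;
  by case: b => c [|[|[|m]]] /=; lia.
Qed.

Lemma count_latest_demote e s : count_latest (map (demote e) s) = 0.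
Proof.
rewrite /count_latest /demote; elim: s => //= b s ->.
by case: b => c [|[|[|m]]] //=; case: e.
Qed.

Lemma count_active_split s :
  count (fun b : block => b.2 == 1) s + count_latest s <= count active s.
Proof.
rewrite /count_latest /active; elim: s => //= b s.
by case: b => c [|[|[|m]]] /=; lia.
Qed.

Variable R : seq (seq nat).

Hypothesis R_nonnil : [::] \notin R.
Hypothesis R_uniq : uniq (flatten R).
Hypothesis R_sorted : all (sorted ltn) R.
Hypothesis R_maximal : sorted (fun r s => head 0 s <= last 0 r) R.

(* For head 0 X < k: no run starts after X among the values < k. *)
Definition latest k X := ~~ has (fun Y => head 0 X < head 0 Y < k) R.

Definition status k X := if latest k X then 2 else nat_of_bool (k <= last 0 X).

Definition cut k X : block := ([seq x <- X | x < k], status k X).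

Definition blocks k := [seq cut k X | X <- R & head 0 X < k].

(** For a run start, the flag says that the run started last still grows; it holds vacuously when no
    run has started. Otherwise it says that [k] ends a run and that a later run has already
    started. *)
Definition run_type k : step :=
  if has (fun X => head 0 X == k) R
  then (true, all (fun Y => (head 0 Y < k) && latest k Y ==> (k <= last 0 Y)) R)
  else (false, has (fun X => (last 0 X == k) && ~~ latest k X) R).

(** The first three conditions are those of the encoding; the last one carries the induction on
    [k]. *)
Definition block_step k : Prop :=
  [/\ blocks k.+1 \in block_family k (run_type k) (blocks k),
      size (block_family k (run_type k) (blocks k))
        <= weight (run_type k) (count active (blocks k)),
      count active (blocks k.+1)
        = target (run_type k) (count active (blocks k))
    & count_latest (blocks k.+1) = 1].

Lemma mem_head_run X : X \in R -> head 0 X \in X.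
Proof. by case: X R_nonnil => [|x X] /negP // _; rewrite mem_head. Qed.

Lemma mem_last_run X : X \in R -> last 0 X \in X.
Proof. by case: X R_nonnil => [|x X] /negP //= _ _; exact: mem_last. Qed.

Lemma run_unique x X Y : X \in R -> Y \in R -> x \in X -> x \in Y -> X = Y.
Proof. exact: uniq_flatten_mem. Qed.

(** Neither head can exceed the other, and runs with equal heads coincide because runs are
    disjoint. *)
Lemma latest_unique k X Y : X \in R -> Y \in R ->
  head 0 X < k -> head 0 Y < k -> latest k X -> latest k Y -> X = Y.
Proof.
move=> XR YR ltX ltY /hasPn/(_ Y YR) /= nXY /hasPn/(_ X XR) /= nYX.
apply: (run_unique XR YR (mem_head_run XR)).
suff -> : head 0 X = head 0 Y by exact: mem_head_run.
by lia.
Qed.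

Lemma sorted_split (u v : seq nat) k : sorted ltn (u ++ k :: v) ->
  all (ltn^~ k) u /\ all (ltn k) v.
Proof.
rewrite sorted_pairwise; last exact: ltn_trans.
rewrite pairwise_cat allrel_consr /= => /and3P [/andP [Hu _] _ /andP [Hv _]].
by [].
Qed.

(** Go left from [X] to the first run whose head is below [k]. The run to its right has head at
    least [k], and by maximality its own last letter is at least that head. Hence a new run is
    placed in front or right after a growing one. *)
Lemma last_small_run k S X :
  sorted (fun r s => head 0 s <= last 0 r) (rcons S X) -> k <= head 0 X ->
  [seq Y <- S | head 0 Y < k] = [::] \/
  exists S' Y, [seq Y <- S | head 0 Y < k] = rcons S' Y /\ k <= last 0 Y.
Proof.
elim/last_ind: S X => [|S Z IHS] X; first by left.
rewrite -cats1 cat_rcons sorted_cat_cons /= andbT => /andP [srt le_XZ] le_kX.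
rewrite filter_rcons; case: ltnP => [lt_Zk|le_kZ]; last exact: IHS srt le_kZ.
by right; exists [seq Y <- S | head 0 Y < k], Z; rewrite (leq_trans le_kX).
Qed.

Lemma cut_other k X : X \in R -> k \notin X ->
  [/\ [seq x <- X | x < k.+1] = [seq x <- X | x < k],
      (head 0 X < k.+1) = (head 0 X < k)
    & (k.+1 <= last 0 X) = (k <= last 0 X)].
Proof.
move=> XR kX; split.
- apply: eq_in_filter => x xX; rewrite ltnS leq_eqVlt.
  by case: eqP xX kX => // -> ->.
- by rewrite ltnS leq_eqVlt; case: eqP (mem_head_run XR) kX => // -> ->.
- by rewrite [RHS]leq_eqVlt; case: eqP (mem_last_run XR) kX => // <- ->.
Qed.

Lemma run_split k : k \in flatten R -> exists R1 u v R2,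
  [/\ R = R1 ++ (u ++ k :: v) :: R2,
      forall Y, Y \in R1 ++ R2 -> Y \in R /\ k \notin Y,
      all (ltn^~ k) u & all (ltn k) v].
Proof.
move=> /flattenP [X XR kX].
have XS : sorted ltn X by exact: (allP R_sorted).
have [u [v EX]] : exists u v, X = u ++ k :: v.
  by case/splitPr: kX => u v; exists u, v.
have [R1 [R2 ER]] : exists R1 R2, R = R1 ++ X :: R2.
  by case/splitPr: XR => R1 R2; exists R1, R2.
rewrite EX in XS; have [Hu Hv] := sorted_split XS.
exists R1, u, v, R2; rewrite -EX; split=> // Y YR.
have YR' : Y \in R.
  by move: YR; rewrite ER !mem_cat inE => /orP [->|->]; rewrite ?orbT.
split=> //; apply/negP => kY.
move: (R_uniq); rewrite ER flatten_cat /= uniq_catCA cat_uniq => /and3P [_].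
rewrite -flatten_cat => /hasPn/(_ k) dis _.
have /dis/negP : k \in flatten (R1 ++ R2) by apply/flattenP; exists Y.
exact.
Qed.

(** Since [u] is nonempty, [k] extends a run already begun, and no other block changes. *)
Lemma blocks_append k R1 u v R2 :
  R = R1 ++ (u ++ k :: v) :: R2 ->
  (forall Y, Y \in R1 ++ R2 -> Y \in R /\ k \notin Y) ->
  all (ltn^~ k) u -> all (ltn k) v -> u != [::] ->
  count_latest (blocks k) = (0 < k) ->
  block_step k.
Proof.
set X := u ++ k :: v => ER other Hu Hv u0 Lk.
have XR : X \in R by rewrite ER mem_cat mem_head orbT.
have hX : head 0 X < k by rewrite /X; case: (u) u0 Hu => //= x ? _ /andP [].
have k_gt0 : 0 < k by exact: leq_ltn_trans hX.
have lX : last 0 X = last k v by rewrite /X last_cat.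
have le_kX : k <= last 0 X.
  rewrite lX; case/lastP: (v) Hv => // s x.
  by rewrite all_rcons last_rcons => /andP [/ltnW].
have RE Y : Y \in R -> Y = X \/ Y \in R1 ++ R2.
  by rewrite ER !mem_cat inE => /or3P [->|/eqP|->]; rewrite ?orbT; auto.
have hk Y : Y \in R -> head 0 Y != k.
  move=> YR; have [->|/other [_]] := RE _ YR; first by rewrite neq_ltn hX.
  by apply: contraNneq => <-; exact: mem_head_run.
(* No run starts at [k]. *)
have lat Y : latest k.+1 Y = latest k Y.
  congr (~~ _); apply: eq_in_has => Z ZR.
  by rewrite ltnS [_ <= k]leq_eqVlt (negPf (hk _ ZR)).
have cutS S : {subset S <= R1 ++ R2} ->
    [seq cut k.+1 Y | Y <- S & head 0 Y < k.+1]
    = [seq cut k Y | Y <- S & head 0 Y < k].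
  move=> sS.
  have -> : [seq Y <- S | head 0 Y < k.+1] = [seq Y <- S | head 0 Y < k].
    apply: eq_in_filter => Y /sS /other [YR kY].
    by have [_ ->] := cut_other YR kY.
  apply/eq_in_map => Y; rewrite mem_filter => /andP [_ /sS /other [YR kY]].
  by have [E1 _ E3] := cut_other YR kY; rewrite /cut /status lat E1 E3.
have s1 : {subset R1 <= R1 ++ R2} by move=> Y; rewrite mem_cat => ->.
have s2 : {subset R2 <= R1 ++ R2} by move=> Y; rewrite mem_cat orbC => ->.
have fu : [seq x <- u | x < k] = u by exact/all_filterP.
have fv m : m <= k.+1 -> [seq x <- v | x < m] = [::].
  move=> le_mk; apply/eqP; rewrite -[_ == _]negbK -has_filter.
  by apply/hasPn => x /(allP Hv) /= lt_kx; rewrite -leqNgt (leq_trans le_mk).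
have Ek : blocks k = [seq cut k Y | Y <- R1 & head 0 Y < k] ++
     (u, status k X) :: [seq cut k Y | Y <- R2 & head 0 Y < k].
  rewrite /blocks ER filter_cat /= -/X hX map_cat /= /cut.
  by rewrite filter_cat /= ltnn fu fv // cats0.
have Ek1 : blocks k.+1 = [seq cut k Y | Y <- R1 & head 0 Y < k] ++
     (rcons u k, status k.+1 X) :: [seq cut k Y | Y <- R2 & head 0 Y < k].
  rewrite /blocks ER filter_cat /= -/X ltnS (ltnW hX) map_cat /= !cutS // /cut.
  rewrite filter_cat /= ltnSn fv // cats1.
  rewrite -(eq_in_filter (a1 := ltn^~ k)) ?fu // => x /(allP Hu).
  by move=> /= lt_xk; rewrite lt_xk ltnW.
have ET : run_type k = (false, (last 0 X == k) && ~~ latest k X).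
  rewrite /run_type ifN; last by apply/hasPn => Y /hk.
  congr pair; rewrite ER has_cat /= -/X.
  have no S : {subset S <= R1 ++ R2} ->
      has (fun Y => (last 0 Y == k) && ~~ latest k Y) S = false.
    move=> sS; apply/negbTE/hasPn => Y /sS /other [YR kY].
    by apply: contra kY => /andP [/eqP <- _]; exact: mem_last_run.
  by rewrite !no // orbF.
(* Exactly one block is marked [2], so at most [J - 1] blocks are marked [1]: this is the weight of
   a peak. *)
have Sz := count_active_split (blocks k).
rewrite Lk k_gt0 in Sz.
rewrite /block_step ET; move: Lk Sz; rewrite k_gt0.
move: Ek Ek1; rewrite /status lat le_kX; move: (map _ _) (map _ _) => A B.
move=> -> ->; rewrite /count_latest.
have keep st : 0 < st -> B ++ (rcons u k, st) :: A
    \in replace_one active (fun b => [:: (rcons b.1 k, b.2)])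
                         (B ++ (u, st) :: A).
  by move=> st_gt0; exact: mem_replace_one.
(* Three cases: [X] is the run started last; it is not and goes on beyond [k]; it is not and ends
   with [k], which is the peak. *)
case: (latest k X); rewrite ?andbF ?andbT /=.
  move=> Lk _; split; rewrite ?size_replace_one ?keep //.
    by rewrite !count_cat.
  by move: Lk; rewrite !count_cat.
case: ltngtP le_kX => //= _ _; move=> Lk Sz.
  split; rewrite ?size_replace_one ?keep //; first by rewrite !count_cat.
  by move: Lk; rewrite !count_cat.
split.
- exact: mem_replace_one.
- move: Sz; rewrite size_replace_one addn1 => Sz.
  by rewrite -ltnS (ltn_predK Sz).
- by rewrite !count_cat /= addnS.
- by move: Lk; rewrite !count_cat.
Qed.

(** Here [k] starts the run [X]: its block enters the list, and all older blocks are demoted. *)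
Lemma blocks_insert k R1 v R2 :
  R = R1 ++ (k :: v) :: R2 ->
  (forall Y, Y \in R1 ++ R2 -> Y \in R /\ k \notin Y) ->
  all (ltn k) v ->
  count_latest (blocks k) = (0 < k) ->
  block_step k.
Proof.
set X := k :: v => ER other Hv Lk.
have XR : X \in R by rewrite ER mem_cat mem_head orbT.
pose e := all (fun Y => (head 0 Y < k) && latest k Y ==> (k <= last 0 Y)) R.
have ET : run_type k = (true, e).
  by rewrite /run_type (_ : has _ R) //; apply/hasP; exists X => /=.
have lower Y : Y \in R1 ++ R2 -> head 0 Y < k ->
    cut k.+1 Y = demote e (cut k Y) /\ status k.+1 Y = (k <= last 0 Y).
  move=> YRR lt_Yk; have [YR kY] := other _ YRR.
  have [E1 _ E3] := cut_other YR kY.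
  (* [X] has started after [Y], so [Y] is no longer the latest run. *)
  have S1 : status k.+1 Y = (k <= last 0 Y).
    rewrite /status E3 /latest; case: hasP => // -[].
    by exists X; rewrite //= lt_Yk ltnSn.
  split=> //; rewrite /demote /cut E1 S1 /status.
  have [lY|_] /= := boolP (latest k Y); last by case: (k <= _).
  congr (_, nat_of_bool _); apply/esym; rewrite /e.
  (* As the latest run is unique, the condition over all runs that defines [e] is a condition on [Y]
     alone. *)
  have [/allP/(_ Y YR) /= | /allPn [Z ZR]] := boolP (all _ _).
    by rewrite lt_Yk lY => /= ->.
  rewrite negb_imply => /andP [/andP [lt_Zk lZ] /negPf ltZ].
  by rewrite (latest_unique YR ZR lt_Yk lt_Zk lY lZ) ltZ.
have cutS S : {subset S <= R1 ++ R2} ->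
    [seq cut k.+1 Y | Y <- S & head 0 Y < k.+1]
    = map (demote e) [seq cut k Y | Y <- S & head 0 Y < k].
  move=> sS.
  have -> : [seq Y <- S | head 0 Y < k.+1] = [seq Y <- S | head 0 Y < k].
    apply: eq_in_filter => Y /sS /other [YR kY].
    by have [_ ->] := cut_other YR kY.
  rewrite -map_comp; apply/eq_in_map => Y.
  rewrite mem_filter => /andP [lt_Yk /sS YRR].
  by have [] := lower Y YRR lt_Yk.
have s1 : {subset R1 <= R1 ++ R2} by move=> Y; rewrite mem_cat => ->.
have s2 : {subset R2 <= R1 ++ R2} by move=> Y; rewrite mem_cat orbC => ->.
pose A := [seq cut k.+1 Y | Y <- R1 & head 0 Y < k.+1].
pose B := [seq cut k.+1 Y | Y <- R2 & head 0 Y < k.+1].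
have Ek : map (demote e) (blocks k) = A ++ B.
  by rewrite /A /B !cutS // -map_cat /blocks ER filter_cat /= ltnn map_cat.
have Ek1 : blocks k.+1 = A ++ ([:: k], 2) :: B.
  rewrite /blocks ER filter_cat /= ltnSn map_cat /= /cut /= ltnSn.
  congr (_ ++ (k :: _, _) :: _).
    apply/eqP; rewrite -[_ == _]negbK -has_filter.
    by apply/hasPn => x /(allP Hv) /=; rewrite -leqNgt.
  rewrite /status ifT //; apply/hasPn => Y _ /=; lia.
have Ae : A = [::] \/ exists A' b, A = rcons A' b /\ active b.
  have := @last_small_run k R1 X; rewrite /A cutS //.
  case=> //.
  - by move: R_maximal; rewrite ER -cat_rcons => /cat_sorted2 [].
  - by move=> ->; left.
  move=> [S' [Y [ES le_kY]]]; right; rewrite ES map_rcons map_rcons.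
  have : Y \in [seq Y <- R1 | head 0 Y < k] by rewrite ES mem_rcons mem_head.
  rewrite mem_filter => /andP [lt_Yk /s1 YRR].
  do 2 eexists; split; first by reflexivity.
  by have [<- ES1] := lower Y YRR lt_Yk; rewrite /active /= ES1 le_kY.
have Ce := count_demote e (blocks k).
(* If [e] fails, some run has already started, so there is exactly one block marked [2] and it
   becomes inactive. *)
have Ze : e = false -> 0 < k.
  move=> /negbT /allPn [Z _]; rewrite negb_imply -andbA => /and3P [lt _ _].
  exact: leq_ltn_trans lt.
have Le := count_latest_demote e (blocks k).
rewrite /block_step ET Ek1; rewrite Ek Lk in Ce Le.
have Ek1' : count active (A ++ ([:: k], 2) :: B) = (count active (A ++ B)).+1.
  by rewrite !count_cat /= addnS.
split.
- rewrite /block_family Ek.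
  case: Ae => [->|[A' [b [-> ab]]]]; first exact: mem_head.
  rewrite inE !cat_rcons (mem_replace_one (fun b => [:: b; ([:: k], 2)])) //.
  by rewrite orbT.
- rewrite /= size_replace_one Ek -Ce; case: (e) Ze => [_|/(_ erefl) ->] /=.
    by rewrite mul0n addn0.
  by rewrite mul1n addn1.
- rewrite Ek1' -Ce; case: (e) Ze => [_|/(_ erefl) ->] /=.
    by rewrite mul0n addn0.
  by rewrite mul1n addn1.
- by move: Le; rewrite /count_latest !count_cat /= addnCA => ->.
Qed.

Lemma blocks_step k : k \in flatten R -> count_latest (blocks k) = (0 < k) ->
  block_step k.
Proof.
move=> /run_split [R1 [u [v [R2 [ER other Hu Hv]]]]].
have [Eu|u0] := altP (u =P [::]); last exact: blocks_append ER other Hu Hv u0.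
by rewrite Eu in ER; exact: blocks_insert ER other Hv.
Qed.

Lemma count_latest_blocks k : (forall j, j < k -> j \in flatten R) ->
  count_latest (blocks k) = (0 < k).
Proof.
elim: k => [_|k IHk in_R].
  by rewrite /blocks (eq_filter (a2 := pred0)) ?filter_pred0.
have [|_ _ _ -> //] := @blocks_step k (in_R k (ltnSn k)).
by apply: IHk => j lt_jk; apply: in_R; exact: ltnW.
Qed.

(** Once all values are read no run can grow, so only the latest run stays active and the blocks
    display the complete runs. *)
Lemma blocks_end m : (forall x, x \in flatten R -> x < m) ->
  blocks m = [seq (X, if latest m X then 2 else 0) | X <- R].
Proof.
move=> lt_m; have lt_run X x : X \in R -> x \in X -> x < m.
  by move=> XR xX; apply: lt_m; apply/flattenP; exists X.
rewrite /blocks (eq_in_filter (a2 := predT)) => [|X XR]; last first.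
  exact: lt_run (XR) (mem_head_run XR).
rewrite filter_predT; apply/eq_in_map => X XR; rewrite /cut /status.
rewrite leqNgt (lt_run _ _ XR (mem_last_run XR)); congr pair.
by apply/all_filterP/allP => x; exact: lt_run.
Qed.

End RunBlocks.

(** * Peaks of the sorted word in terms of run heads and run ends *)

Section RunSort.

Variable n : nat.
Implicit Types (v : 'I_n) (w : seq 'I_n).

Definition run_values w : seq (seq nat) :=
  [seq [seq val x | x <- r] | r <- runs w].

Lemma run_values_nonnil w : [::] \notin run_values w.
Proof.
apply/mapP => -[[|x r] rw] //= _.
by have := runs_nonnil w; rewrite rw.
Qed.

Lemma flatten_run_values w : flatten (run_values w) = [seq val x | x <- w].
Proof. by rewrite -map_flatten flatten_runs. Qed.

Lemma run_values_increasing w : all (sorted ltn) (run_values w).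
Proof.
rewrite all_map; apply: sub_all (runs_increasing w) => r /=.
by rewrite sorted_map.
Qed.

Lemma run_values_maximal w :
  sorted (fun r s => head 0 s <= last 0 r) (run_values w).
Proof.
case: w => [|v w] //; rewrite sorted_map.
have := runs_maximal (v :: w) v.
apply: (@sub_in_sorted _ [pred r | r != [::]]).
  move=> [|x r] [|y s] //= _ _.
  by rewrite (last_map val).
by apply/allP => r rw; apply: contraNneq (runs_nonnil (v :: w)) => <-.
Qed.

(** Lexicographic order on nonempty words compares the first letters first. *)
Lemma runsort_heads w v :
  sorted (fun r s => head v r <= head v s)
         (sort (fun r s : seqlexi 'I_n => (r <= s)%O) (runs w)).
Proof.
have := sort_sorted (@Order.TotalTheory.le_total _ (seqlexi 'I_n)) (runs w).
apply: (@sub_in_sorted _ [pred r | r != [::]]).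
  move=> [|x r] [|y s] //= _ _; rewrite Order.SeqLexiOrder.lexi_cons.
  by case/andP.
apply/allP => r; rewrite mem_sort => rw.
by apply: contraNneq (runs_nonnil w) => <-.
Qed.

(** Inside its run [v] is followed by a larger letter. At the end of [X] it is followed by the head
    of the next run, the smallest of the later heads, so that head is below [v] iff some head lies
    between [head v X] and [v]. Then [v] is not the head of [X], and the letter before it is
    smaller. *)
Lemma mem_peak_flatten (S : seq (seq 'I_n)) a v b :
  uniq (flatten S) -> [::] \notin S -> a ++ v :: b \in S ->
  sorted (fun x y : 'I_n => x < y) (a ++ v :: b) ->
  pairwise (fun r s => head v r <= head v s) S ->
  (v \in peak_values (flatten S)) =
  (last v (a ++ v :: b) == v) &&
  has (fun s => head v (a ++ v :: b) < head v s < v) S.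
Proof.
set X := a ++ v :: b => US S0 XS srt hS.
have lt_trans : transitive (fun x y : 'I_n => x < y).
  by move=> ? ? ?; exact: ltn_trans.
have [lt_av lt_vb] : all (fun x : 'I_n => x < v) a /\
    all (fun x : 'I_n => v < x) b.
  move: srt; rewrite sorted_pairwise // pairwise_cat allrel_consr.
  by case/and3P => /andP [? _] _ /= /andP [? _].
have [S1 [S2 ES]] : exists S1 S2, S = S1 ++ X :: S2.
  by case/splitPr: XS => S1 S2; exists S1, S2.
move: hS; rewrite ES pairwise_cat allrel_consr.
move=> /and3P [/andP [h1 _] _ /= /andP [h2 hS2]].
have no1 : has (fun s => head v X < head v s < v) S1 = false.
  apply/negbTE/hasPn => s /(allP h1) /= le_sX.
  by rewrite negb_and -leqNgt le_sX.
have -> : flatten (S1 ++ X :: S2) = (flatten S1 ++ a) ++ v :: (b ++ flatten S2).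
  by rewrite flatten_cat /= /X -!catA.
rewrite mem_peak_values; last by move: US; rewrite ES flatten_cat /= /X -!catA.
rewrite has_cat no1 /= ltnn /=.
case: b => [|y b] in X srt lt_vb US XS ES h1 h2 no1 *; last first.
  have /= /andP [lt_vy _] := lt_vb.
  have lt_yv : (y < v) = false by rewrite ltnNge ltnW.
  rewrite /= lt_yv andbF; apply/esym/negbTE.
  rewrite negb_and; apply/orP; left; rewrite /X last_cat /=.
  have := allP lt_vb _ (mem_last y b).
  by rewrite neq_ltn => ->; rewrite orbT.
have -> : last v X = v by rewrite /X last_cat.
rewrite eqxx /=.
case: S2 => [|Y S2] in US ES h2 hS2 *; first by rewrite /= ltnn andbF.
have YS : Y \in S by rewrite ES mem_cat !inE eqxx !orbT.
have hY : head v Y \in Y.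
  by case: (Y) YS S0 => [|z Z] YS; [rewrite YS | rewrite /= mem_head].
have -> : head v ([::] ++ flatten (Y :: S2)) = head v Y.
  by case: (Y) hY.
rewrite -/X; have /= /andP [le_XY _] := h2.
have [lt_Yv|le_vY] := ltnP (head v Y) v; last first.
  rewrite !andbF; apply/esym/negbTE/hasPn => s sS2.
  have le_vs : v <= head v s.
    by apply: leq_trans le_vY _; have /= /andP [/allP/(_ s sS2)] := hS2.
  by rewrite negb_and -!leqNgt le_vs orbT.
have lt_Xv : head v X < v := leq_ltn_trans le_XY lt_Yv.
have hX : head v X \in X.
  by rewrite /X; case: (a) => [|z Z] /=; rewrite mem_head.
(* The heads are only weakly sorted; strictness comes from the letters being distinct. *)
have neq_XY : head v X != head v Y.
  move: US; rewrite ES flatten_cat cat_uniq => /and3P [_ _].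
  rewrite /= cat_uniq => /and3P [_ /hasPn/(_ (head v Y)) dis _].
  have /dis : head v Y \in Y ++ flatten S2 by rewrite mem_cat hY.
  by apply: contraNneq => <-.
have a0 : a != [::] by apply: contraTneq lt_Xv => Ea; rewrite /X Ea /= ltnn.
rewrite andbT [X in _ = X || _](_ : _ = true).
  case/lastP: (a) a0 lt_av => // s x _; rewrite all_rcons => /andP [lt_xv _].
  by rewrite last_cat last_rcons lt_xv.
by rewrite ltn_neqAle neq_XY le_XY.
Qed.

(** Sorting keeps the set of runs, so the condition on heads and ends can be tested on the unsorted
    runs, where it is expressed by [latest]. *)
Lemma mem_sorted_peaks w v : uniq w -> v \in w ->
  (v \in peak_values (runsort w)) =
  has (fun X => (last 0 X == v) && ~~ latest (run_values w) v X) (run_values w).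
Proof.
move=> Uw vw.
have ET : has (fun X => (last 0 X == v) && ~~ latest (run_values w) v X)
              (run_values w)
   = has (fun r => (last v r == v) &&
              has (fun s => head v r < head v s < v) (runs w)) (runs w).
  rewrite has_map; apply: eq_in_has => r rw /=.
  have headE s : s \in runs w -> head 0 [seq val x | x <- s] = head v s.
    by case: s => // sw; move: (runs_nonnil w); rewrite sw.
  rewrite (_ : last 0 _ = last v r); last first.
    case: r rw => [|x r] rw; last by rewrite /= last_map.
    by move: (runs_nonnil w); rewrite rw.
  rewrite /latest negbK has_map headE //; congr (_ && _).
  by apply: eq_in_has => s sw /=; rewrite headE.
rewrite {}ET /runsort; have := runsort_heads w v.
set S := sort _ _; have memS : S =i runs w by move=> r; rewrite mem_sort.
have US : uniq (flatten S) by rewrite (perm_uniq (perm_runsort w)).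
have Sincr : all (sorted (fun x y : 'I_n => x < y)) S.
  by rewrite (eq_all_r memS) runs_increasing.
have S0 : [::] \notin S by rewrite memS runs_nonnil.
rewrite -(eq_has_r memS).
rewrite (eq_has (a2 := fun r => (last v r == v) &&
                          has (fun s => head v r < head v s < v) S));
  last first.
  by move=> r /=; rewrite (eq_has_r memS).
have /flattenP [X XS vX] : v \in flatten S.
  by rewrite (perm_mem (perm_runsort w)).
have mem_last_S r : r \in S -> last v r \in r.
  by case: r S0 => [|x r] /negP //= _ _; exact: mem_last.
have mem_head_S r : r \in S -> head v r \in r.
  by case: r S0 => [|x r] /negP //= _ _; rewrite mem_head.
have hasE :
  has (fun r => (last v r == v) && has (fun s => head v r < head v s < v) S) S
  = (last v X == v) && has (fun s => head v X < head v s < v) S.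
  apply/hasP/idP => [[r rS /andP [/eqP Er Hr]]|HX]; last by exists X.
  suff <- : r = X by rewrite Er eqxx.
  by apply: (uniq_flatten_mem US rS XS _ vX); rewrite -Er mem_last_S.
rewrite {}hasE sorted_pairwise; last by move=> ? ? ?; exact: leq_trans.
have := allP Sincr X XS; case/splitPr: vX XS => a b.
by move=> Sab srt hS; exact: mem_peak_flatten.
Qed.

End RunSort.

(** * Both encodings applied to permutations, and the equality of the sums *)

Section Encodings.

Variable n : nat.
Implicit Types (v : 'I_n) (w : seq 'I_n) (p : 'S_n).

Definition is_start (t : step) := t.1.
Definition is_peak (t : step) := ~~ t.1 && t.2.

Lemma factor_type_stats w v : uniq w -> v \in w ->
  is_start (factor_type v [seq val x | x <- w]) = (v \in run_starts w) /\
  is_peak (factor_type v [seq val x | x <- w]) = (v \in peak_values w).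
Proof.
move=> Uw vw; case/splitPr: vw Uw => w1 w2 Uw.
rewrite mem_run_starts // mem_peak_values // map_cat map_cons.
rewrite factor_typeE; last first.
  move: Uw; rewrite cat_uniq => /and3P [_ /norP [v_w1 _] _].
  by rewrite (mem_map val_inj).
rewrite /is_start /is_peak /= last_map.
rewrite (_ : head _ _ = val (head v w2)); last by case: (w2).
split=> //; rewrite !(ltnNge _ v).
by case: (v <= last v w1); case: (v <= head v w2).
Qed.

Lemma run_type_stats w v : uniq w -> v \in w ->
  is_start (run_type (run_values w) v) = (v \in run_starts w) /\
  is_peak (run_type (run_values w) v) = (v \in peak_values (runsort w)).
Proof.
move=> Uw vw; set R := run_values w.
have UR : uniq (flatten R).
  by rewrite flatten_run_values map_inj_uniq //; exact: val_inj.
have R0 : [::] \notin R := run_values_nonnil w.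
have E1 : has (fun X => head 0 X == v) R = (v \in run_starts w).
  rewrite inE /R /run_values has_map; have := runs_nonnil w.
  elim: (runs w) => //= -[|x r] rs IHrs //=.
  by rewrite inE => /IHrs ->; rewrite inE val_eqE eq_sym.
rewrite mem_sorted_peaks // -/R /is_start /is_peak /run_type E1.
case: ifP => /= Hv; split=> //; apply/esym/negbTE/hasPn => X XR.
move: Hv; rewrite -E1 => /hasP [Z ZR /eqP EZ].
rewrite negb_and negbK; case: eqP => //= EX.
(* A run start that also ends a run forms a run alone, and no head lies strictly between [v] and
   [v]. *)
have EXZ : X = Z.
  apply: (uniq_flatten_mem UR XR ZR (x := nat_of_ord v)).
    by rewrite -EX; exact: (mem_last_run R0 XR).
  by rewrite -EZ; exact: (mem_head_run R0 ZR).
by apply/hasPn => Y _; rewrite EXZ EZ; lia.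
Qed.

Lemma one_line_uniq p : uniq (one_line p).
Proof. by rewrite map_inj_uniq ?enum_uniq //; exact: perm_inj. Qed.

Lemma mem_one_line p v : v \in one_line p.
Proof. by rewrite -(permKV p v) map_f ?mem_enum. Qed.

Definition word p : seq nat := [seq val x | x <- one_line p].

Lemma word_inj : injective word.
Proof.
move=> p q /(inj_map val_inj) /eq_in_map E.
by apply/permP => i; apply: E; rewrite mem_enum.
Qed.

Lemma word_uniq p : uniq (word p).
Proof. by rewrite map_inj_uniq ?one_line_uniq //; exact: val_inj. Qed.

Lemma mem_word p k : (k \in word p) = (k < n).
Proof.
apply/mapP/idP => [[x _ ->]|lt_kn]; first exact: ltn_ord.
by exists (Ordinal lt_kn); rewrite ?mem_one_line.
Qed.

(** At the end the whole word is the only factor, or there is none if [n = 0]; so the last node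
    determines the permutation. *)
Lemma perm_factor_types :
  perm_eq [seq [seq factor_type k (word p) | k <- iota 0 n] | p <- enum 'S_n]
          [seq [seq x.1 | x <- c] | c <- codes n 0].
Proof.
have node_end p : factors n (word p) = [seq c <- [:: word p] | c != [::]].
  by rewrite /factors pieces_all //; apply/allP => x; rewrite mem_word.
apply: (@perm_steps 'S_n (seq (seq nat)) size n factor_family
          (fun k p => factors k (word p))
          (fun k p => factor_type k (word p)) [::]).
- by move=> p; exact: factors0.
- by [].
- move=> k p lt_kn; rewrite size_factor_family.
  have k_in : k \in word p by rewrite mem_word.
  by case: (factors_step (word_uniq p) k_in).
- by move=> p; rewrite node_end /=; case: ifP.
- move=> p q /(congr1 flatten); rewrite !node_end => E; apply: word_inj.
  have flat (c : seq nat) : flatten [seq d <- [:: c] | d != [::]] = c.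
    by case: c => //= x c; rewrite cats0.
  by rewrite -(flat (word p)) E flat.
- exact: card_Sn.
Qed.

(** At the end the active blocks are those marked [2], of which there is at most one, and the blocks
    concatenate to the word. *)
Lemma perm_run_types :
  perm_eq [seq [seq run_type (run_values (one_line p)) k | k <- iota 0 n]
          | p <- enum 'S_n]
          [seq [seq x.1 | x <- c] | c <- codes n 0].
Proof.
pose R p := run_values (one_line p).
have RE p : flatten (R p) = word p by exact: flatten_run_values.
have R0 p : [::] \notin R p := run_values_nonnil _.
have RU p : uniq (flatten (R p)) by rewrite RE word_uniq.
have Rinc p : all (sorted ltn) (R p) := run_values_increasing _.
have Rmax p := run_values_maximal (one_line p).
have Lk p k : k <= n -> count_latest (blocks (R p) k) = (0 < k).
  move=> le_kn.
  apply: (count_latest_blocks (R0 p) (RU p) (Rinc p) (Rmax p)) => j lt_jk.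
  by rewrite RE mem_word (leq_trans lt_jk).
have node_end p :
  blocks (R p) n = [seq (X, if latest (R p) n X then 2 else 0) | X <- R p].
  by apply: (blocks_end (R0 p)) => x; rewrite RE mem_word.
apply: (@perm_steps 'S_n (seq block) (count active) n block_family
          (fun k p => blocks (R p) k) (fun k p => run_type (R p) k) [::]).
- by move=> p; rewrite /blocks (eq_filter (a2 := pred0)) ?filter_pred0.
- by [].
- move=> k p lt_kn; have k_in : k \in flatten (R p) by rewrite RE mem_word.
  have := Lk p k (ltnW lt_kn).
  by case/(blocks_step (R0 p) (RU p) (Rinc p) (Rmax p) k_in).
- move=> p.
  have <- : count_latest (blocks (R p) n) = count active (blocks (R p) n).
    rewrite node_end /count_latest !count_map; apply: eq_count => X /=.
    by rewrite /active /=; case: ifP.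
  by rewrite Lk //; case: (n).
- move=> p q /(congr1 (fun s : seq block => flatten (map fst s))).
  have flat r : flatten [seq b.1 | b <- blocks (R r) n] = word r.
    by rewrite node_end -map_comp (@eq_map _ _ _ id) // map_id RE.
  by rewrite !flat => /word_inj.
- exact: card_Sn.
Qed.

Lemma perm_types :
  perm_eq [seq [seq factor_type k (word p) | k <- iota 0 n] | p <- enum 'S_n]
          [seq [seq run_type (run_values (one_line p)) k | k <- iota 0 n]
          | p <- enum 'S_n].
Proof.
by rewrite (perm_trans perm_factor_types) // perm_sym perm_run_types.
Qed.

(** Both sets are functions of the step sequence, and the two multisets of sequences agree. The
    arbitrary [F] serves the identity with the [x] variables as well as the one without them. *)
Lemma sum_PKV_SPV (V : nmodType) (F : {set 'I_n} -> {set 'I_n} -> V) :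
  (\sum_(p : 'S_n) F (RS p) (PKV p) = \sum_(p : 'S_n) F (RS p) (SPV p))%R.
Proof.
(* The default [(true, true)] is never read: the sequences have length [n]. *)
pose starts (c : seq step) := [set v : 'I_n | is_start (nth (true, true) c v)].
pose peaks (c : seq step) := [set v : 'I_n | is_peak (nth (true, true) c v)].
have nthE (f : nat -> step) v :
  nth (true, true) [seq f k | k <- iota 0 n] v = f v.
  by rewrite (nth_map 0) ?size_iota // nth_iota.
transitivity (\sum_(c <- [seq [seq factor_type k (word p) | k <- iota 0 n]
                         | p <- enum 'S_n]) F (starts c) (peaks c))%R.
  rewrite big_map big_enum; apply: eq_bigr => p _; congr F; apply/setP => v;
  have [E1 E2] := factor_type_stats (one_line_uniq p) (mem_one_line p v);
  by rewrite [RHS]inE nthE.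
rewrite (perm_big _ perm_types) big_map big_enum; apply: eq_bigr => p _.
by congr F; apply/setP => v;
  have [E1 E2] := run_type_stats (one_line_uniq p) (mem_one_line p v);
  rewrite [LHS]inE nthE.
Qed.

End Encodings.

Theorem theorem4p17 (n : nat) (hn : 1 <= n) :
  (\sum_(p : 'S_n) xmon (RS p) * ymon (PKV p) =
   \sum_(p : 'S_n) xmon (RS p) * ymon (SPV p))%R
  /\
  (\sum_(p : 'S_n) ymon (PKV p) = \sum_(p : 'S_n) ymon (SPV p))%R.
Proof.
split; first exact: (sum_PKV_SPV (fun A B => xmon A * ymon B)%R).
exact: (sum_PKV_SPV (fun _ B => ymon B)).
Qed.
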